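(* Let $X$ be a $\delta$-hyperbolic graph. Then $X$ has no fat bigons.
   Context: All graphs (in particular $X$) are connected, have uniformly bounded degree, and are metric spaces with the shortest path metric (edges of length 1). For $r\ge 0$, $N_r(Y)=\{x : d(x,Y)\le r\}$. $X$ is $\delta$-hyperbolic if for any geodesic triangle with sides $\gamma_1,\gamma_2,\gamma_3$ one has $\gamma_1\subseteq N_\delta(\gamma_2\cup\gamma_3)$. Let $x_0$ be a base vertex of $X$, and let $x$ be a vertex. Given $L\ge 1$ and $s,C\ge 0$, an $(L,s,C)$-bigon at $x$ is a pair of paths $\alpha_1,\alpha_2$ in $X$ from $x_0$ to $x$ such that (1) the length satisfies $l(\alpha_i)\le L\,d(x_0,x)$ for $i=1,2$; (2) with $B=N_C(\{x_0,x\})$, we have $d(\alpha_1\setminus B,\alpha_2\setminus B)>s$ (this holds by convention if one of the two sets is empty). Let $\mathcal B^X(L,s,C)$ be the set of vertices $x$ such that there exists an $(L,s,C)$-bigon at $x$. $X$ has no fat bigons at $x_0$ if for every $L\ge 1$ there exists $s$ such that for every $C$ the set $\mathcal B^X(L,s,C)$ is a bounded subset of $X$. This property does not depend on the choice of base vertex $x_0$, so the basepoint is omitted. *)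

(* Defs.v *)
From HB Require Import structures.
From Stdlib Require Import Relation_Operators.
From mathcomp Require Import all_boot all_order all_algebra.
From mathcomp Require Import all_classical all_reals all_analysis.
From mathcomp Require Import ring lra.

Set Implicit Arguments.
Unset Strict Implicit.
Unset Printing Implicit Defensive.

Import Order.TTheory GRing.Theory Num.Theory.
Import numFieldNormedType.Exports.

Local Open Scope classical_set_scope.
Local Open Scope ring_scope.

(** * Metric notions *)

Section MetricNotions.
Context {R : realType} {X : metricType R}.
Implicit Types (A B Y : set X) (p q r x : X) (a : R -> X).

(* Values in \bar R, so that the distance to the empty set is +oo. *)
Definition setdist A B : \bar R :=
  ereal_inf [set (mdist z.1 z.2)%:E | z in A `*` B].

Definition nbhd (r : R) Y : set X :=
  [set x | (setdist [set x] Y <= r%:E)%E].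

Definition metric_bounded A : Prop :=
  exists M : R, forall x y, A x -> A y -> mdist x y <= M.

Definition geodesic p q a : Prop :=
  [/\ a 0 = p, a (mdist p q) = q &
    {in `[0, mdist p q] &, forall s t, mdist (a s) (a t) = `|s - t|}].

Definition geodesic_image p q a : set X := a @` `[0, mdist p q].

(* Quantifying over all p, q, r and all geodesics covers the three sides of
   every triangle by cyclic permutation of the vertices. *)
Definition hyperbolic (delta : R) : Prop :=
  forall p q r (a1 a2 a3 : R -> X),
    geodesic p q a1 -> geodesic q r a2 -> geodesic r p a3 ->
    geodesic_image p q a1 `<=`
      nbhd delta (geodesic_image q r a2 `|` geodesic_image r p a3).

Definition is_path p q a : Prop :=
  [/\ {within `[0, 1], continuous a}, a 0 = p & a 1 = q].

Definition path_image a : set X := a @` `[0, 1].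

(* Metric analogue of [variation] from realfun. *)
Definition path_variation a (s : seq R) : R :=
  \sum_(0 <= i < size s)
    mdist (a (nth 1 (0 :: s) i)) (a (nth 1 (0 :: s) i.+1)).

Definition path_length a : \bar R :=
  ereal_sup [set (path_variation a s)%:E | s in itv_partition 0 1].

Definition bigon (L s C : R) x0 x a1 a2 : Prop :=
  let B := nbhd C [set x0; x] in
  [/\ is_path x0 x a1 /\ is_path x0 x a2,
      (path_length a1 <= (L * mdist x0 x)%:E)%E,
      (path_length a2 <= (L * mdist x0 x)%:E)%E &
      (s%:E < setdist (path_image a1 `\` B) (path_image a2 `\` B))%E].

End MetricNotions.

Arguments hyperbolic {R} X delta.

(** * Graphs and their geometric realization *)

(* Loops and multiple edges are allowed. The two ends of an edge [e] are
   [endpoint e false] and [endpoint e true]; this orientation only serves to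
   parametrize [e] by [0, 1]. The degree of [v] is the number of pairs (e, b)
   with [endpoint e b = v], so that a loop counts twice. *)
Record graph := Graph {
  vertex : Type;
  edge : Type;
  endpoint : edge -> bool -> vertex;
  graph_connected : forall u v : vertex,
    clos_refl_trans vertex
      (fun x y => exists e b, endpoint e b = x /\ endpoint e (~~ b) = y) u v;
  graph_bounded_degree : exists D : nat, forall v : vertex,
    ([set h : edge * bool | endpoint h.1 h.2 = v] #<= `I_D)%card }.

Section Realization.
Context (R : realType) (G : graph).

(* The interior points of an edge, and the vertices: every point of the
   geometric realization is listed exactly once. *)
Inductive realization : Type :=
| Vtx of vertex G
| Inner of edge G & {t : R | 0 < t < 1}.

(* [at_coord e t p]: [p] is the point with parameter [t] of the closed
   edge [e]. *)
Inductive at_coord (e : edge G) : R -> realization -> Prop :=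
| at_coord0 : at_coord e 0 (Vtx (endpoint e false))
| at_coord1 : at_coord e 1 (Vtx (endpoint e true))
| at_coord_inner t : at_coord e (val t) (Inner e t).

(* [chain p q l]: there is a piecewise linear path of length [l] from [p]
   to [q], each piece of which lies in a closed edge of length 1. *)
Inductive chain : realization -> realization -> R -> Prop :=
| chain_nil p : chain p p 0
| chain_cons e s t p q r l :
    at_coord e s p -> at_coord e t q -> chain q r l ->
    chain p r (`|s - t| + l).

Definition graph_dist (p q : realization) : R := inf [set l | chain p q l].

Lemma chain_ge0 p q l : chain p q l -> 0 <= l.
Proof. by elim=> // *; apply: addr_ge0. Qed.

Lemma chain_cat p q r k l : chain p q k -> chain q r l -> chain p r (k + l).
Proof.
elim=> [p'|e s t p' q' r' k' ps qt _ IH] c; first by rewrite add0r.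
by rewrite -addrA; apply: chain_cons ps qt (IH c).
Qed.

Lemma chain1 e s t p q : at_coord e s p -> at_coord e t q ->
  chain p q `|s - t|.
Proof.
by move=> ps qt; rewrite -[`|_|]addr0; apply: chain_cons ps qt (chain_nil _).
Qed.

Lemma chain_sym p q l : chain p q l -> chain q p l.
Proof.
elim=> [p'|e s t p' q' r' k' ps qt _ IH]; first exact: chain_nil.
by rewrite addrC distrC; apply: chain_cat IH (chain1 qt ps).
Qed.

Lemma chain_vtx u v : exists l, chain (Vtx u) (Vtx v) l.
Proof.
elim: (graph_connected u v) => [x y [e [b [<- <-]]]|x|x y z _ [k ck] _ [l cl]].
- case: b => /=; first by eexists; apply: chain1 (at_coord1 e) (at_coord0 e).
  by eexists; apply: chain1 (at_coord0 e) (at_coord1 e).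
- by exists 0; apply: chain_nil.
- by exists (k + l); apply: chain_cat ck cl.
Qed.

Lemma chain_ex p q : exists l, chain p q l.
Proof.
have toV r : exists v l, chain r (Vtx v) l.
  case: r => [v|e t]; first by exists v, 0; apply: chain_nil.
  by do 2 eexists; apply: chain1 (at_coord_inner e t) (at_coord0 e).
have [u [k ck]] := toV p; have [v [l cl]] := toV q.
have [m cm] := chain_vtx u v.
by exists (k + (m + l)); apply: chain_cat ck (chain_cat cm (chain_sym cl)).
Qed.

Lemma chain_has_inf p q : has_inf [set l | chain p q l].
Proof.
split; first by have [l] := chain_ex p q; exists l.
by exists 0 => l /chain_ge0.
Qed.

Lemma graph_dist_le p q l : chain p q l -> graph_dist p q <= l.
Proof. by move=> c; apply: ge_inf => //; have [] := chain_has_inf p q. Qed.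

Lemma le_graph_dist p q m :
  (forall l, chain p q l -> m <= l) -> m <= graph_dist p q.
Proof. by move=> h; apply: lb_le_inf => //; have [] := chain_has_inf p q. Qed.

Lemma graph_dist_ge0 p q : 0 <= graph_dist p q.
Proof. by apply: le_graph_dist => l /chain_ge0. Qed.

Lemma graph_distxx p : graph_dist p p = 0.
Proof.
by apply/le_anti; rewrite graph_dist_ge0 andbT; apply/graph_dist_le/chain_nil.
Qed.

Lemma graph_dist_sym p q : graph_dist p q = graph_dist q p.
Proof.
by congr inf; apply/seteqP; split=> l; apply: chain_sym.
Qed.

Lemma graph_dist_triangle q p r :
  graph_dist p r <= graph_dist p q + graph_dist q r.
Proof.
rewrite -lerBlDr; apply: le_graph_dist => k ck.
rewrite lerBlDr -lerBlDl; apply: le_graph_dist => l cl.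
rewrite lerBlDl; apply: graph_dist_le; exact: chain_cat ck cl.
Qed.

(* A lower bound for the distance to [p], 1-Lipschitz along edges. *)
Let bump (p q : realization) : R :=
  match p, q with
  | Vtx v, Vtx w => if `[< w = v >] then 0 else 1
  | Vtx v, Inner e t =>
      Num.min (if `[< endpoint e false = v >] then val t else 1)
              (if `[< endpoint e true = v >] then 1 - val t else 1)
  | Inner _ t, Vtx _ => Num.min (val t) (1 - val t)
  | Inner e t, Inner e' t' =>
      if `[< e' = e >]
      then Num.min `|val t' - val t| (Num.min (val t) (1 - val t))
      else Num.min (val t) (1 - val t)
  end.

Let edge_bump (p : realization) (e : edge G) (u : R) : R :=
  match p with
  | Vtx v =>
      Num.min (if `[< endpoint e false = v >] then u else 1)
              (if `[< endpoint e true = v >] then 1 - u else 1)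
  | Inner e' t =>
      if `[< e = e' >]
      then Num.min `|u - val t| (Num.min (val t) (1 - val t))
      else Num.min (val t) (1 - val t)
  end.

Let bumpE p e u q : at_coord e u q -> bump p q = edge_bump p e u.
Proof.
case=> [||t]; case: p => [v|e' [t' /= t'01]] //=.
- by case: asboolP => _; case: asboolP => _; rewrite ?subr0 /Num.min;
    case: ifP => //; lra.
- by case: asboolP => _ //; rewrite sub0r normrN /Num.min; move: t'01;
    case: (ler0P t') => ? /andP[? ?]; repeat case: ifP; lra.
- by case: asboolP => _; case: asboolP => _; rewrite ?subrr /Num.min;
    case: ifP => //; lra.
- by case: asboolP => _ //; rewrite /Num.min; move: t'01;
    case: (ler0P (1 - t')) => ? /andP[? ?]; repeat case: ifP; lra.
Qed.

Let edge_bump_lip p e u v : edge_bump p e v <= edge_bump p e u + `|u - v|.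
Proof.
case: p => [w|e' [t t01]] /=.
  by case: asboolP => _; case: asboolP => _; rewrite /Num.min;
    case: (ler0P (u - v)); repeat case: ifP; lra.
case: asboolP => _; last by rewrite lerDl.
have := ler_distD u v t; rewrite (distrC v u).
have := normr_ge0 (u - v).
by rewrite /Num.min; repeat case: ifP; lra.
Qed.

Let bump_chain p q r l : chain q r l -> bump p r <= bump p q + l.
Proof.
elim=> [q'|e s t q' q'' r' k qs qt _ IH]; first by rewrite addr0.
apply: le_trans IH _; rewrite (bumpE p qs) (bumpE p qt) addrA lerD2r.
exact: edge_bump_lip.
Qed.

Let bumpxx p : bump p p = 0.
Proof.
case: p => [v|e [t /= t01]]; first by rewrite /= asboolT.
rewrite /= asboolT // subrr normr0 /Num.min; move: t01 => /andP[? ?].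
by repeat case: ifP; lra.
Qed.

Let bump_eq0 p q : bump p q <= 0 -> p = q.
Proof.
case: p q => [v|e [t /= t01]] [w|e' [t' /= t'01]] /=.
- by case: asboolP => [->//|_]; rewrite ler10.
- have [? ?] := andP t'01; move=> h; exfalso; move: h.
  by case: asboolP => _; case: asboolP => _; rewrite /Num.min; case: ifP; lra.
- have [? ?] := andP t01; move=> h; exfalso; move: h.
  by rewrite /Num.min; case: ifP; lra.
- have [? ?] := andP t01; case: asboolP => [->|_] h; last first.
    by exfalso; move: h; rewrite /Num.min; case: ifP; lra.
  have [tt'|tt'] := eqVneq t t'.
    move: t01 t'01 {h}; rewrite -tt' => t01 t'01.
    by rewrite (bool_irrelevance t01 t'01).
  exfalso; have : 0 < `|t' - t| by rewrite normr_gt0 subr_eq0 eq_sym.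
  by move: h; rewrite /Num.min; repeat case: ifP; lra.
Qed.

Lemma graph_dist_positivity p q : graph_dist p q = 0 -> p = q.
Proof.
move=> d0; apply: bump_eq0; rewrite -d0; apply: le_graph_dist => l c.
by rewrite -[l]add0r -(bumpxx p); apply: bump_chain.
Qed.

HB.instance Definition _ := gen_eqMixin realization.
HB.instance Definition _ := gen_choiceMixin realization.
HB.instance Definition _ := isMetric.Build R realization
  graph_distxx graph_dist_positivity graph_dist_sym graph_dist_triangle.

(** * Fat bigons *)

(* The vertices at which there is an (L, s, C)-bigon based at [x0]. *)
Definition bigon_vertices (x0 : vertex G) (L s C : R) : set realization :=
  [set Vtx x | x in
    [set x | exists a1 a2 : R -> realization,
      bigon L s C (Vtx x0) (Vtx x) a1 a2]].

Definition no_fat_bigons_at (x0 : vertex G) : Prop :=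
  forall L : R, 1 <= L ->
  exists2 s : R, 0 <= s &
  forall C : R, 0 <= C -> metric_bounded (bigon_vertices x0 L s C).

Definition no_fat_bigons : Prop := forall x0, no_fat_bigons_at x0.

End Realization.

(* Main.v *)
Require Import Defs.
From mathcomp Require Import all_boot all_order all_algebra.
From mathcomp Require Import all_classical all_reals all_analysis.
From mathcomp Require Import ring lra.

(** Write a, b for the end points of a bigon, n for their distance, and (y|z)_x
for the Gromov product, [gromov_product x y z]. For a point p read (b|p)_a as
the position of the projection of p to a geodesic from a to b, and (a|b)_p as
the distance of p to that geodesic. Hyperbolicity enters only through the
four-point inequality with a constant K: of the three ways to pair up four
points and add the two distances, the two largest sums differ by at most K.

The four-point inequality makes the projection contracting ([short_step]): a
step of length at most D either moves the position by at most K, or starts at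
distance at most D + K from the geodesic. Cut a path of length at most L n from
a to b into about L n / D steps of length at most D. Its positions run from 0 to
n, so every u in [0, n] lies between the positions of two consecutive cut points
([shadow_path]): either the path passes near the point of position u, or u is
within K of the position of one of the L n / D cut points. For D a suitable
multiple of (K + 1) L the second kind of u fills about a quarter of [0, n]. With
two paths there remain, once n is large with respect to C, values of u that are
of the first kind for both paths and farther than C + D from both 0 and n
([uncovered_point]). At such a u both paths pass near the same point, hence near
each other ([shadows_meet]), and outside the balls of radius C about a and b.
The resulting bound s on the distance between the two paths depends on K and L
only, so there is no bigon with parameters L, s, C at a vertex far from the base
vertex ([bigon_close]).

The four-point inequality itself follows from thin triangles. Distances between
vertices are lengths of shortest edge walks ([mdist_vtx]), so that vertices are
joined by geodesics. A side of a triangle has a point that is close to both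
other sides ([central_point]); applying thinness at that point to a second
triangle on the same side gives the inequality for four vertices
([four_point_vertices]), and every point is within distance 1 of a vertex. *)

Set Implicit Arguments.
Unset Strict Implicit.
Unset Printing Implicit Defensive.

Import Order.TTheory GRing.Theory Num.Theory.
Import numFieldNormedType.Exports.

Local Open Scope classical_set_scope.
Local Open Scope ring_scope.

(** * Cutting paths into steps of bounded length *)

Lemma mdist_continuous (R : realType) (X : metricType R) (p : X) :
  continuous (mdist p : X -> R).
Proof.
move=> x; apply/cvgrPdist_lt => e e0; near=> y.
have xy : mdist x y < e.
  by near: y; have := nbhsx_ballx x e e0; rewrite ballEmdist.
have := metric_triangle p x y; have := metric_triangle p y x.
by rewrite (metric_sym y x) ltr_distl; lra.
Unshelve. all: by end_near. Qed.

Section Variation.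
Context {R : realType} {X : metricType R}.
Implicit Types (a : R -> X) (s : seq R).

(** The variation along a partition that starts at [u]: it gives [path_variation]
a recursion on the partition. *)
Definition variation_from a (u : R) s : R :=
  \sum_(0 <= i < size s)
    mdist (a (nth 1 (u :: s) i)) (a (nth 1 (u :: s) i.+1)).

Lemma variation_from_cons a u v s :
  variation_from a u (v :: s) = mdist (a u) (a v) + variation_from a v s.
Proof. by rewrite /variation_from big_nat_recl. Qed.

(** The greedy subdivision: as long as the path still leaves the ball of radius
[D] about the current point, the intermediate value theorem provides a next
point at distance exactly [D]. Each such step adds [D] to the variation, so the
process stops for a path of finite length; [m] is the number of steps allowed,
and the first alternative says that they were all made. The last step may be
short, hence the predecessor in the second alternative. *)
Lemma coarse_partition a (D : R) (m : nat) u :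
  0 < D -> {within `[0, 1], continuous a} -> 0 <= u < 1 ->
  exists s, [/\ itv_partition u 1 s, {in u :: s, forall z, 0 <= z <= 1} &
    m%:R * D <= variation_from a u s \/
    (forall i, (i < size s)%N ->
       mdist (a (nth 1 (u :: s) i)) (a (nth 1 (u :: s) i.+1)) <= D) /\
    (size s).-1%:R * D <= variation_from a u s].
Proof.
move=> D0 ca; elim: m u => [|m IH] u /andP[u0 u1].
  exists [:: 1]; split; first exact: itv_partition1.
    by move=> z; rewrite !inE => /orP[] /eqP->; lra.
  by left; rewrite mul0r; apply: sumr_ge0 => *; apply: mdist_ge0.
have [du|du] := leP (mdist (a u) (a 1)) D.
  exists [:: 1]; split; first exact: itv_partition1.
    by move=> z; rewrite !inE => /orP[] /eqP->; lra.
  right; split; first by case.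
  by rewrite mul0r; apply: sumr_ge0 => *; apply: mdist_ge0.
have cf : {within `[u, 1], continuous (fun t => mdist (a u) (a t) : R)}.
  have sub : `[u, 1] `<=` `[0, 1 : R].
    by move=> t /=; rewrite !in_itv /= => /andP[ut ->]; rewrite (le_trans u0).
  move=> t; apply: continuous_comp; first exact: (continuous_subspaceW sub ca).
  exact: mdist_continuous.
have /(IVT (ltW u1) cf)[v] :
    Num.min (mdist (a u) (a u)) (mdist (a u) (a 1)) <= D <=
    Num.max (mdist (a u) (a u)) (mdist (a u) (a 1)).
  by rewrite mdistxx min_l ?max_r ?mdist_ge0 // (ltW D0) (ltW du).
rewrite in_itv /= => /andP[uv v1] dv.
have {}uv : u < v.
  rewrite lt_neqAle uv andbT; apply/eqP => e.
  by move: dv D0; rewrite -e mdistxx => ->; rewrite ltxx.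
have {}v1 : v < 1.
  by rewrite lt_neqAle v1 andbT; apply/eqP => e; move: du; rewrite -e dv ltxx.
have [|s [ps s01 h]] := IH v; first by rewrite v1 andbT (le_trans u0 (ltW uv)).
exists (v :: s); split.
- by case: ps => p l; split => //=; rewrite uv.
- by move=> z; rewrite in_cons => /orP[/eqP->|/s01//]; lra.
rewrite variation_from_cons dv; case: h => [h|[st h]]; [left|right].
  by rewrite -natr1 mulrDl mul1r; lra.
split; first by case=> [|i] //= ; [rewrite dv|move=> /st].
have -> : (size (v :: s)).-1 = (size s).-1.+1.
  case: ps => _; case: s {s01 h st} => //= /eqP v1E.
  by move: v1; rewrite v1E ltxx.
by rewrite -natr1 mulrDl mul1r; lra.
Qed.

End Variation.

(** * Two combinatorial facts about the real line *)

Lemma ltr_crossing (R : realDomainType) (f : nat -> R) k u :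
  f 0%N <= u < f k -> exists2 i, (i < k)%N & f i <= u < f i.+1.
Proof.
move=> /andP[f0 fk].
have ex : exists i, u < f i by exists k.
case: (ex_minnP ex) => -[|i] fi mini; first by move: f0; rewrite leNgt fi.
exists i; first exact: mini.
by rewrite fi andbT leNgt; apply/negP => /mini; rewrite ltnn.
Qed.

(** A pigeonhole replaces the comparison of measures: points spaced by more than
[2 * r] lie in different intervals of radius [r], so among [size ts + 1] of them
one avoids all the intervals centred at [ts]. *)
Lemma uncovered_point (R : realFieldType) (r A : R) (ts : seq R) : 0 <= r ->
  exists2 u, A <= u <= A + (2 * r + 1) * (size ts)%:R &
    forall t, t \in ts -> r < `|u - t|.
Proof.
move=> r0; pose w := 2 * r + 1.
have w0 : 0 < w by rewrite /w; lra.
pose u (i : 'I_(size ts).+1) := A + w * i%:R.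
have [[i hi]|/forallNP no] :=
    pselect (exists i, forall t, t \in ts -> r < `|u i - t|).
  exists (u i) => //; rewrite lerDl lerD2l ler_pM2l // ler_nat -ltnS ltn_ord.
  by rewrite mulr_ge0 // ltW.
have /choice[j jP] (i : 'I_(size ts).+1) :
    exists j : 'I_(size ts), `|u i - ts`_j| <= r.
  have /existsNP[t /not_implyP[tts /negP]] := no i.
  rewrite -leNgt => ht.
  have jlt : (index t ts < size ts)%N by rewrite index_mem.
  by exists (Ordinal jlt); rewrite /= nth_index.
have inj_j : injective j.
  move=> i i' e; have := jP i; rewrite e => h; have {}h' := jP i'.
  have {h h'} : `|u i - u i'| <= 2 * r.
    have := ler_distD (ts`_(j i')) (u i) (u i').
    by rewrite (distrC (ts`_(j i')) (u i')); lra.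
  rewrite /u opprD addrACA subrr add0r -mulrBr normrM (gtr0_norm w0) => h.
  apply/val_inj/eqP; rewrite eq_le; apply: contraTT h => /= ii'.
  rewrite -ltNge.
  have : 1 <= `|i%:R - i'%:R : R|.
    have [lt|lt|eq] := ltngtP i i'; last by rewrite eq !lexx in ii'.
      by rewrite distrC -natrB 1?ltnW // normr_nat ler1n subn_gt0.
    by rewrite -natrB 1?ltnW // normr_nat ler1n subn_gt0.
  move=> h1; apply: lt_le_trans (_ : w <= _); first by rewrite /w; lra.
  by rewrite -[leLHS]mulr1 ler_pM2l.
by have := leq_card _ inj_j; rewrite !card_ord ltnn.
Qed.

(** * Paths in spaces satisfying the four-point inequality *)

Section FourPoint.
Context {R : realType} {X : metricType R}.
Implicit Types (p q x y a b : X).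

Definition gromov_product x y z : R :=
  (mdist x y + mdist x z - mdist y z) / 2.

Definition four_point (K : R) : Prop := forall p q a b,
  mdist p q + mdist a b <= mdist a p + mdist b q + K \/
  mdist p q + mdist a b <= mdist a q + mdist b p + K.

Lemma four_point_ge0 K (p : X) : four_point K -> 0 <= K.
Proof. by move=> /(_ p p p p); rewrite mdistxx; lra. Qed.

Lemma gromov_product_lip a b p q :
  `|gromov_product a b p - gromov_product a b q| <= mdist p q.
Proof.
rewrite /gromov_product ler_norml.
have := metric_triangle a p q; have := metric_triangle a q p.
have := metric_triangle b p q; have := metric_triangle b q p.
by rewrite (metric_sym q p); lra.
Qed.

(** The change of position is half the difference of the sums of distances for the
two pairings that separate [a] from [b]. If that difference exceeds [K], then
the larger sum is at most [mdist a b + mdist p q + K], and moving its [q] to [p]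
costs another [mdist p q], which bounds [gromov_product p a b]. *)
Lemma short_step (K D : R) a b p q : four_point K -> mdist p q <= D ->
  `|gromov_product a b p - gromov_product a b q| <= K \/
  gromov_product p a b <= D + K.
Proof.
move=> fp dpq; have K0 := four_point_ge0 p fp.
rewrite /gromov_product ler_norml.
have := fp a p b q; have := fp a q b p.
have := metric_triangle a q p; have := metric_triangle a p q.
rewrite (metric_sym b a) (metric_sym q p) (metric_sym q a) (metric_sym p a).
rewrite (metric_sym p b); have := metric_triangle b q p.
have := metric_triangle b p q; rewrite (metric_sym q p).
move=> ? ? ? ? [h1|h1] [h2|h2]; solve [left; lra | right; lra].
Qed.

(** The list [ts] consists of the positions of the cut points. If [u] lies between
two consecutive ones and the step moves the position by at most [K], then [u] is
within [K] of [ts]; otherwise the step starts near the geodesic, and since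
positions are 1-Lipschitz its starting point has position within [D] of [u]. *)
Lemma shadow_path (a : R -> X) x0 x (K D l : R) : four_point K -> 0 < D ->
  is_path x0 x a -> (path_length a <= l%:E)%E ->
  exists2 ts : seq R, (size ts)%:R * D <= l + D &
  forall u, 0 <= u < mdist x0 x ->
    (exists2 t, t \in ts & `|u - t| <= K) \/
    exists z, [/\ 0 <= z <= 1, `|u - gromov_product x0 x (a z)| <= D &
      gromov_product (a z) x0 x <= D + K].
Proof.
move=> fp D0 [ca a0 a1] al.
(* More than l / D steps of length D would exceed the length of the path. *)
pose m := Num.truncn (l / D).
have lm : l < m.+1%:R * D by rewrite -ltr_pdivrMr // truncnS_gt.
have u0 : 0 <= (0 : R) < 1 by rewrite lexx ltr01.
have [s [ps s01 hs]] := coarse_partition m.+1 D0 ca u0.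
have vl : variation_from a 0 s <= l.
  by rewrite -lee_fin; apply: le_trans al; apply: ereal_sup_ubound; exists s.
have {hs}[hs|[steps hs]] := hs; first by lra.
pose f i := gromov_product x0 x (a (nth 1 (0 :: s) i)).
exists [seq f i | i <- iota 0 (size s)].
  rewrite size_map size_iota; case: s {ps s01 f} steps hs vl => [|v s] /= _.
    by rewrite !mul0r; lra.
  by rewrite -natr1 mulrDl; lra.
have f0 : f 0%N = 0.
  by rewrite /f /= a0 /gromov_product mdistxx (metric_sym x x0) addr0 subrr mul0r.
have fs : f (size s) = mdist x0 x.
  rewrite /f nth_last /=; case: ps => _ /eqP ->.
  by rewrite a1 /gromov_product mdistxx; lra.
move=> u; rewrite -[X in X <= u]f0 -fs => /ltr_crossing[i ilt /andP[fiu ufi]].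
have := short_step x0 x fp (steps i ilt).
have flip := le_trans (gromov_product_lip x0 x _ _) (steps i ilt).
move: flip; rewrite -/(f i) -/(f i.+1) => flip [near|good]; [left|right].
  exists (f i); first by apply: map_f; rewrite mem_iota.
  by move: near; rewrite !ler_norml; lra.
exists (nth 1 (0 :: s) i); split => //.
  by apply: s01; apply: mem_nth; rewrite ltnW.
by rewrite -/(f i); move: flip; rewrite !ler_norml; lra.
Qed.

(** Two points near the geodesic and of nearly equal positions are close: in both
pairings that separate [a] from [b] the sum of distances exceeds [mdist a b]
only by the two Gromov products and the difference of the positions. *)
Lemma shadows_meet a b p q (K D r u : R) : four_point K ->
  gromov_product p a b <= r -> gromov_product q a b <= r ->
  `|u - gromov_product a b p| <= D -> `|u - gromov_product a b q| <= D ->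
  mdist p q <= 2 * D + 2 * r + K.
Proof.
move=> fp; rewrite /gromov_product !ler_norml.
rewrite (metric_sym p a) (metric_sym p b) (metric_sym q a) (metric_sym q b).
by have := fp p q a b; move=> [h|h]; lra.
Qed.

Lemma nbhd_lt (r r' : R) (Y : set X) p :
  nbhd r Y p -> r < r' -> exists2 y, Y y & mdist p y < r'.
Proof.
move=> pY rr'.
have /ereal_inf_lt[_ [[z y] /= [-> Yy] <-]] : (setdist [set p] Y < r'%:E)%E.
  by apply: le_lt_trans pY _; rewrite lte_fin.
by rewrite lte_fin => zy; exists y.
Qed.

Lemma notin_nbhd_ends a b p (C : R) :
  C < mdist p a -> C < mdist p b -> ~ nbhd C [set a; b] p.
Proof.
move=> pa pb pB.
have /(nbhd_lt pB) : C < Num.min (mdist p a) (mdist p b).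
  by rewrite lt_min pa pb.
by case=> y [->|->]; rewrite lt_min ltxx ?andbF.
Qed.

(** The constants: each path has at most [L * n / D + 1] cut points, which exclude
intervals of total length about [(2 * K + 1) * (L * n / D + 1)], so this [D]
makes the share of each path [n / 4] up to a constant. The rest of [0, n] is
longer than the two end pieces of length [C + D + 1] once [n] exceeds the stated
bound. The fatness is the bound of [shadows_meet] for [r = D + K]. *)
Lemma bigon_close (K L C : R) x0 x (a1 a2 : R -> X) :
  four_point K -> 1 <= L -> 0 <= C ->
  let D := 4 * L * (2 * K + 1) in
  bigon L (4 * D + 3 * K) C x0 x a1 a2 ->
  mdist x0 x <= 4 * (C + D + 2 * K + 2).
Proof.
move=> fp L1 C0 D [[p1 p2] l1 l2 fat].
have K0 := four_point_ge0 x0 fp.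
set n := mdist x0 x in l1 l2 *.
have w0 : 0 < 2 * K + 1 by lra.
have D0 : 0 < D by rewrite /D mulr_gt0 // mulr_gt0 //; lra.
have [//|big] := leP n (4 * (C + D + 2 * K + 2)).
have [ts1 size1 cover1] := shadow_path fp D0 p1 l1.
have [ts2 size2 cover2] := shadow_path fp D0 p2 l2.
have [u urange uout] := uncovered_point (C + D + 1) (ts1 ++ ts2) K0.
have bound (ts : seq R) : (size ts)%:R * D <= L * n + D ->
    4 * ((2 * K + 1) * (size ts)%:R) <= n + 4 * (2 * K + 1).
  move=> h; have L0 : 0 < L by lra.
  rewrite -(ler_pM2l L0); apply: le_trans (_ : L * n + D <= _).
    by apply: le_trans h; rewrite /D; lra.
  by rewrite /D; lra.
move: (bound _ size1) (bound _ size2) urange => {}size1 {}size2.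
rewrite size_cat natrD mulrDr => /andP[ulo uhi].
have u0n : 0 <= u < n by apply/andP; split; lra.
have un : u <= n - (C + D + 1) by lra.
have [[t tin tu]|[z1 [z1in d1 g1]]] := cover1 u u0n.
  by have := uout t; rewrite mem_cat tin ltNge tu => /(_ isT).
have [[t tin tu]|[z2 [z2in d2 g2]]] := cover2 u u0n.
  by have := uout t; rewrite mem_cat tin orbT ltNge tu => /(_ isT).
have away z (a : R -> X) : `|u - gromov_product x0 x (a z)| <= D ->
    ~ nbhd C [set x0; x] (a z).
  move=> dz; apply: notin_nbhd_ends; move: dz; rewrite ler_norml.
    have := metric_triangle x0 (a z) x; rewrite (metric_sym (a z) x0).
    by rewrite /gromov_product (metric_sym (a z) x) -/n; lra.
  have := metric_triangle x0 x (a z); rewrite (metric_sym (a z) x).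
  have := metric_triangle x0 (a z) x; rewrite (metric_sym (a z) x).
  by rewrite /gromov_product -/n; lra.
have dz := shadows_meet fp g1 g2 d1 d2.
exfalso; move: fat; apply/negP; rewrite -leNgt.
apply: (@le_trans _ _ (mdist (a1 z1) (a2 z2))%:E); last by rewrite lee_fin; lra.
apply: ereal_inf_lbound; exists (a1 z1, a2 z2) => //=; split; split.
- by exists z1 => //=; rewrite in_itv.
- exact: away d1.
- by exists z2 => //=; rewrite in_itv.
- exact: away d2.
Qed.

End FourPoint.

(** * Geodesics between vertices *)

Section EdgeWalks.
Context {X : graph}.
Implicit Types (u v w : vertex X).

Inductive edge_walk v : vertex X -> nat -> Prop :=
| edge_walk0 : edge_walk v v 0
| edge_walkS e b k : edge_walk v (endpoint e (~~ b)) k ->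
    edge_walk v (endpoint e b) k.+1.

Lemma edge_walk_cat u v w k l :
  edge_walk v u k -> edge_walk w v l -> exists m, edge_walk w u m.
Proof.
move=> uv vw; elim: uv => [|e b k' _ [m IH]]; first by exists l.
by exists m.+1; apply: edge_walkS.
Qed.

Lemma edge_walk_exists v u : exists k, edge_walk v u k.
Proof.
elim: (graph_connected u v) => [x y [e [b [<- <-]]]|x|x y z _ [k xy] _ [l yz]].
- by exists 1%N; apply: edge_walkS; apply: edge_walk0.
- by exists 0%N; apply: edge_walk0.
- exact: edge_walk_cat xy yz.
Qed.

Lemma shortest_edge_walk v u : exists k, edge_walk v u k /\
  forall m, edge_walk v u m -> (k <= m)%N.
Proof.
have ex : exists k, `[< edge_walk v u k >].
  by have [k hk] := edge_walk_exists v u; exists k; apply/asboolP.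
case: (ex_minnP ex) => k /asboolP hk mink; exists k; split=> // m hm.
by apply: mink; apply/asboolP.
Qed.

Definition edge_dist v u : nat := sval (cid (shortest_edge_walk v u)).

Lemma edge_distP v u : edge_walk v u (edge_dist v u).
Proof. by rewrite /edge_dist; case: cid => k []. Qed.

Lemma edge_dist_le v u m : edge_walk v u m -> (edge_dist v u <= m)%N.
Proof. by rewrite /edge_dist; case: cid => k [_ /= h] /h. Qed.

Lemma edge_distxx v : edge_dist v v = 0%N.
Proof. by apply/eqP; rewrite -leqn0; apply/edge_dist_le/edge_walk0. Qed.

Lemma edge_dist_endpoint v e b :
  (edge_dist v (endpoint e b) <= (edge_dist v (endpoint e (~~ b))).+1)%N.
Proof. exact/edge_dist_le/edge_walkS/edge_distP. Qed.

End EdgeWalks.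

Section Realization.
Context {R : realType} {X : graph}.
Implicit Types (u v w : vertex X) (p q : realization R X).

(** The length of a shortest route to [v] from the point with parameter [t] on [e],
which leaves [e] through one of its two ends. *)
Definition dist_along v (e : edge X) (t : R) : R :=
  Num.min ((edge_dist v (endpoint e false))%:R + t)
          ((edge_dist v (endpoint e true))%:R + (1 - t)).

Definition extended_edge_dist v p : R :=
  match p with
  | Vtx u => (edge_dist v u)%:R
  | Inner e t => dist_along v e (val t)
  end.

(** The formula is consistent at vertices, whichever edge parametrizes them,
because the two ends of an edge differ by at most 1 in [edge_dist v]. *)
Lemma extended_edge_distE v e t p :
  at_coord e t p -> extended_edge_dist v p = dist_along v e t.
Proof.
have h b : (edge_dist v (endpoint e b))%:R <=
    (edge_dist v (endpoint e (~~ b)))%:R + 1 :> R.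
  by rewrite natr1 ler_nat edge_dist_endpoint.
have := h false; have := h true => /= ht hf.
by case=> [||s] //=; rewrite /dist_along /Num.min; case: ifP; lra.
Qed.

Lemma dist_along_lip v e s t :
  dist_along v e s <= dist_along v e t + `|s - t|.
Proof.
by rewrite /dist_along /Num.min; case: (ler0P (s - t)); repeat case: ifP; lra.
Qed.

(** Being 1-Lipschitz along every chain, [extended_edge_dist v] bounds the distance
to [v] from below; this is how piecewise linear chains that turn back inside an
edge are compared with edge walks. *)
Lemma extended_edge_dist_chain v p q l : chain p q l ->
  extended_edge_dist v p <= extended_edge_dist v q + l.
Proof.
elim=> [p'|e s t p' q' r k ps qt _ IH]; first by rewrite addr0.
rewrite (extended_edge_distE v ps).
have := dist_along_lip v e s t; rewrite -(extended_edge_distE v qt).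
lra.
Qed.

Lemma edge_dist_le_mdist v u : (edge_dist v u)%:R <= mdist (Vtx R u) (Vtx R v).
Proof.
apply: le_graph_dist => l /(extended_edge_dist_chain v).
by rewrite /= edge_distxx add0r.
Qed.

(** On [0, 1] the fallback branch occurs only for [t = 1]. *)
Definition edge_point (e : edge X) (t : R) : realization R X :=
  if t == 0 then Vtx R (endpoint e false) else
  if insub t is Some t' then Inner e t' else Vtx R (endpoint e true).

Lemma edge_pointP e t : 0 <= t <= 1 -> at_coord e t (edge_point e t).
Proof.
move=> /andP[t0 t1]; rewrite /edge_point; case: eqP => [->|/eqP tn0].
  exact: at_coord0.
case: insubP => [t' _ <-|]; first exact: at_coord_inner.
rewrite lt_neqAle eq_sym tn0 t0 /= -leNgt => t1'.
have -> : t = 1 by apply/eqP; rewrite eq_le t1 t1'.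
exact: at_coord1.
Qed.

Lemma edge_mdist_le (e : edge X) s t p q :
  at_coord e s p -> at_coord e t q -> mdist p q <= `|s - t|.
Proof. by move=> ps qt; apply/graph_dist_le/(chain1 ps qt). Qed.

Lemma edge_parametrization e b : exists a : R -> realization R X,
  [/\ a 0 = Vtx R (endpoint e b), a 1 = Vtx R (endpoint e (~~ b)) &
    forall s t, 0 <= s <= 1 -> 0 <= t <= 1 -> mdist (a s) (a t) <= `|s - t|].
Proof.
have at0 : edge_point e 0 = Vtx R (endpoint e false) by rewrite /edge_point eqxx.
have at1 : edge_point e 1 = Vtx R (endpoint e true).
  by rewrite /edge_point oner_eq0 insubF // ltxx andbF.
have lip s t : 0 <= s <= 1 -> 0 <= t <= 1 ->
    mdist (edge_point e s) (edge_point e t) <= `|s - t|.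
  by move=> /(edge_pointP e) ps /(edge_pointP e) pt; apply: edge_mdist_le ps pt.
case: b; last by exists (edge_point e).
exists (fun t => edge_point e (1 - t)); split; rewrite ?subr0 ?subrr //.
move=> s t s01 t01; have -> : `|s - t| = `|(1 - s) - (1 - t)|.
  by rewrite distrC; congr `|_|; ring.
by apply: lip; lra.
Qed.

Lemma edge_walk_parametrization v u k : edge_walk v u k ->
  exists a : R -> realization R X,
  [/\ a 0 = Vtx R u, a k%:R = Vtx R v &
    forall s t, 0 <= s <= k%:R -> 0 <= t <= k%:R ->
      mdist (a s) (a t) <= `|s - t|].
Proof.
elim=> [|e b {}k _ [a [a0 ak lip]]].
  by exists (fun=> Vtx R v); split=> // *; rewrite mdistxx.
have [c [c0 c1 clip]] := edge_parametrization e b.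
pose d t := if t <= 1 then c t else a (t - 1).
have d1 t : 1 <= t -> d t = a (t - 1).
  rewrite /d; case: ifP => // t1 t1'.
  have -> : t = 1 by lra.
  by rewrite subrr c1 a0.
have wlog_le s t : s <= t -> 0 <= s <= k.+1%:R -> 0 <= t <= k.+1%:R ->
    mdist (d s) (d t) <= `|s - t|.
  rewrite -natr1 => st s0k t0k; rewrite distrC ger0_norm ?subr_ge0 //.
  have [t1|t1] := leP t 1.
    rewrite /d t1 (le_trans st t1).
    by apply: le_trans (clip _ _ _ _) _; [lra|lra|rewrite ler_norml; lra].
  have [s1|s1] := leP 1 s.
    rewrite !d1 //; last exact: ltW.
    by apply: le_trans (lip _ _ _ _) _; [lra|lra|rewrite ler_norml; lra].
  rewrite (d1 t (ltW t1)) /d (ltW s1).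
  have := metric_triangle (c s) (c 1) (a (t - 1)).
  have := clip s 1; rewrite distrC ger0_norm; last by lra.
  have := lip 0 (t - 1); rewrite distrC ger0_norm; last by lra.
  rewrite c1 a0.
  move=> h1 h2; have := h1 ltac:(lra) ltac:(lra).
  by have := h2 ltac:(lra) ltac:(lra); lra.
exists d; split.
- by rewrite /d ler01.
- by rewrite -natr1 d1 ?addrK // lerDr.
- move=> s t; have [st|ts] := leP s t; first exact: wlog_le.
  by move=> s0 t0; rewrite metric_sym distrC; apply: wlog_le => //; apply: ltW.
Qed.

Lemma mdist_vtx u v : mdist (Vtx R u) (Vtx R v) = (edge_dist v u)%:R.
Proof.
apply/eqP; rewrite eq_le edge_dist_le_mdist andbT.
have [a [<- <- lip]] := edge_walk_parametrization (edge_distP v u).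
apply: le_trans (lip _ _ _ _) _; rewrite ?lexx ?ler0n //.
by rewrite sub0r normrN normr_nat.
Qed.

(** A 1-Lipschitz path of length [mdist x y] between [x] and [y] is an isometric
embedding, by the triangle inequality. *)
Lemma geodesic_exists u v : exists a : R -> realization R X,
  geodesic (Vtx R u) (Vtx R v) a.
Proof.
have [a [a0 ak lip]] := edge_walk_parametrization (edge_distP v u).
exists a; split=> //; first by rewrite mdist_vtx.
have : mdist (a 0) (a (edge_dist v u)%:R) = (edge_dist v u)%:R.
  by rewrite a0 ak mdist_vtx.
rewrite mdist_vtx; set n := (edge_dist v u)%:R in lip * => an s t.
have n0 : 0 <= n by rewrite ler0n.
wlog st : s t / s <= t.
  move=> h; have [|/ltW ts] := leP s t; first exact: h.
  by move=> s0 t0; rewrite metric_sym distrC; apply: h.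
rewrite !in_itv /= => s0 t0; apply/eqP; rewrite eq_le lip //=.
have [s_lo s_hi] := andP s0; have [t_lo t_hi] := andP t0.
have h1 : mdist (a 0) (a s) <= s.
  by rewrite -[leRHS]ger0_norm // -[`|s|]normrN -sub0r lip // lexx.
have h2 : mdist (a t) (a n) <= n - t.
  by rewrite -[leRHS]ger0_norm ?subr_ge0 // distrC lip // lexx andbT.
have := metric_triangle (a 0) (a s) (a n).
have := metric_triangle (a s) (a t) (a n).
by rewrite distrC ger0_norm ?subr_ge0 //; lra.
Qed.

Lemma near_vertex p : exists v, mdist p (Vtx R v) <= 1.
Proof.
case: p => [v|e t]; first by exists v; rewrite mdistxx.
exists (endpoint e false).
apply: le_trans (edge_mdist_le (at_coord_inner e t) (at_coord0 _ e)) _.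
by case: t => /= t t01; rewrite subr0 ger0_norm; lra.
Qed.

End Realization.

(** * Thin triangles and the four-point inequality *)

Section Betweenness.
Context {R : realType} {X : metricType R}.
Implicit Types (p x y : X) (k : R).

(** The only trace of geodesics kept in the estimates: the point [u] need not lie
on a chosen geodesic, only be metrically between [x] and [y]. *)
Definition near_segment k p x y : Prop :=
  exists2 u, mdist p u <= k & mdist x u + mdist u y = mdist x y.

Lemma near_segmentC k p x y : near_segment k p x y -> near_segment k p y x.
Proof.
case=> u pu xy; exists u => //.
by rewrite addrC !(metric_sym _ x) !(metric_sym y).
Qed.

Lemma near_segment_shift k p q x y :
  near_segment k p x y -> near_segment (mdist q p + k) q x y.
Proof.
by case=> u pu xuy; exists u => //; have := metric_triangle q p u; lra.
Qed.

Lemma near_segment_sum k p x y : near_segment k p x y ->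
  mdist x p + mdist p y <= mdist x y + 2 * k.
Proof.
case=> u pu xuy; have := metric_triangle x u p; have := metric_triangle p u y.
by rewrite (metric_sym u p); lra.
Qed.

Lemma geodesic_image_between x y a p : geodesic x y a ->
  geodesic_image x y a p -> mdist x p + mdist p y = mdist x y.
Proof.
move=> [a0 an iso] [t /= tin <-]; have n0 := mdist_ge0 x y.
move: (tin); rewrite in_itv /= => /andP[t0 tn].
have -> : mdist x (a t) = t.
  by rewrite -a0 iso ?in_itv /= ?lexx // sub0r normrN ger0_norm.
have -> : mdist (a t) y = mdist x y - t.
  rewrite -[y in LHS]an iso ?in_itv /= ?lexx ?n0 //.
  by rewrite distrC ger0_norm ?subr_ge0.
by rewrite addrC subrK.
Qed.

End Betweenness.

Section Hyperbolic.
Context {R : realType} {X : graph} {delta : R}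
  (hyp : hyperbolic (realization R X) delta).
Local Notation V := (Vtx R).
Implicit Types x y z w : vertex X.

(** The extra 1 is there because [nbhd] is defined by an infimum, which need not be
attained. *)
Lemma slim_triangle x y z a p : geodesic (V y) (V z) a ->
  geodesic_image (V y) (V z) a p ->
  near_segment (delta + 1) p (V y) (V x) \/
  near_segment (delta + 1) p (V z) (V x).
Proof.
move=> ga pa; have [b gb] := @geodesic_exists R X z x.
have [c gc] := @geodesic_exists R X x y.
have lt1 : delta < delta + 1 by lra.
have [q [qb|qc] pq] := nbhd_lt (hyp ga gb gc pa) lt1.
  by right; exists q; [exact: ltW|exact: geodesic_image_between gb qb].
left; apply: near_segmentC.
by exists q; [exact: ltW|exact: geodesic_image_between gc qc].
Qed.

(** A discrete connectedness argument along the side from [y] to [z], whose length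
is an integer: the first of its integral points that is close to the side [zx]
is [y] itself or is at distance 1 from a point that is not close to [zx], hence
close to the side [yx]. *)
Lemma central_point x y z a : geodesic (V y) (V z) a ->
  exists p, [/\ geodesic_image (V y) (V z) a p,
    near_segment (delta + 2) p (V y) (V x) &
    near_segment (delta + 2) p (V z) (V x)].
Proof.
move=> ga; have [a0 an iso] := ga; set n := edge_dist z y.
have nE : mdist (V y) (V z) = n%:R by exact: mdist_vtx.
have img i : (i <= n)%N -> geodesic_image (V y) (V z) a (a i%:R).
  by move=> i_n; exists i%:R => //=; rewrite in_itv /= nE ler0n ler_nat.
have weaken p u : near_segment (delta + 1) p u (V x) ->
    near_segment (delta + 2) p u (V x).
  by case=> q pq; exists q => //; lra.
have d0 p u : near_segment (delta + 1) p u (V x) -> 0 <= delta + 1.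
  by case=> q; have := mdist_ge0 p q; lra.
have self p : 0 <= delta + 1 -> near_segment (delta + 2) p p (V x).
  by exists p; rewrite mdistxx ?add0r //; lra.
have ex : exists i, (i <= n)%N &&
    `[< near_segment (delta + 1) (a i%:R) (V z) (V x) >].
  exists n; rewrite leqnn /=; apply/asboolP.
  have := slim_triangle x ga (img n (leqnn n)).
  rewrite -nE an => h; have k0 : 0 <= delta + 1 by case: h => /d0.
  by exists (V z); rewrite mdistxx ?add0r.
case: (ex_minnP ex) => -[|i] /andP[i_n /asboolP iz] mini.
  exists (a 0); split; [exact: (img 0%N)| |exact: weaken].
  by rewrite a0; apply: self; apply: d0 iz.
exists (a i.+1%:R); split; [exact: img| |exact: weaken].
have [iy|iz'] := slim_triangle x ga (img i (ltnW i_n)); last first.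
  by have := mini i; rewrite ltnW //= asboolT // ltnn => /(_ isT).
have := near_segment_shift (a i.+1%:R) iy.
rewrite iso ?in_itv /= ?nE ?ler0n ?ler_nat ?i_n ?(ltnW i_n) //.
rewrite -natr1 (addrC i%:R) addrK normr1.
by have -> : 1 + (delta + 1) = delta + 2 by ring.
Qed.

(** Let [p] be central on the side [yz] of the triangle [xyz]. The triangle [wyz]
puts [p] close to [yw] or to [zw]. In the first case the routes [x-p-w] and
[y-p-z] exchange their halves at [p] into [z-p-x] and [y-p-w], both almost
geodesic; the second case is symmetric. *)
Lemma four_point_vertices x y z w :
  let K := 4 * delta + 6 in
  mdist (V x) (V w) + mdist (V y) (V z) <=
    mdist (V y) (V x) + mdist (V z) (V w) + K \/
  mdist (V x) (V w) + mdist (V y) (V z) <=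
    mdist (V y) (V w) + mdist (V z) (V x) + K.
Proof.
have [a ga] := @geodesic_exists R X y z.
have [p [pa /near_segment_sum py /near_segment_sum pz]] := central_point x ga.
have yz := geodesic_image_between ga pa.
have := metric_triangle (V x) p (V w).
rewrite (metric_sym (V x) p) (metric_sym p (V z)) in yz *.
have [[u pu yuw]|[u pu zuw]] := slim_triangle w ga pa; [right|left].
  have := metric_triangle p u (V w); have := metric_triangle (V y) u p.
  by rewrite (metric_sym u p); lra.
have := metric_triangle p u (V w); have := metric_triangle (V z) u p.
by rewrite (metric_sym u p); lra.
Qed.

(** Replacing the four points by vertices within distance 1 changes each of the
two sums of distances by at most 4. *)
Lemma hyperbolic_four_point :
  four_point (X := realization R X) (4 * delta + 14).
Proof.
move=> p q a b.
have [p' pp'] := near_vertex p; have [q' qq'] := near_vertex q.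
have [a' aa'] := near_vertex a; have [b' bb'] := near_vertex b.
have lip (r r' s s' : realization R X) : mdist r r' <= 1 -> mdist s s' <= 1 ->
    `|mdist r s - mdist r' s'| <= 2.
  move=> rr ss; rewrite ler_norml.
  have := metric_triangle r r' s; have := metric_triangle r' s' s.
  have := metric_triangle r' r s'; have := metric_triangle r s s'.
  by rewrite (metric_sym r' r) (metric_sym s' s); lra.
move: (lip _ _ _ _ pp' qq') (lip _ _ _ _ aa' bb') (lip _ _ _ _ aa' pp')
  (lip _ _ _ _ bb' qq') (lip _ _ _ _ aa' qq') (lip _ _ _ _ bb' pp').
rewrite !ler_norml => ? ? ? ? ? ?.
by have [h|h] := four_point_vertices p' a' b' q'; [left|right]; lra.
Qed.

End Hyperbolic.

Theorem lemma2p6 (R : realType) (X : graph) (delta : R) :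
  hyperbolic (realization R X) delta -> no_fat_bigons R X.
Proof.
move=> /hyperbolic_four_point fp; rewrite /no_fat_bigons /no_fat_bigons_at.
(* The definition carries, as local definitions, the auxiliary functions of the
   construction of the metric. *)
cbv zeta => x0 L L1.
set K := 4 * delta + 14 in fp.
have K0 := four_point_ge0 (Vtx R x0) fp.
have D0 : 0 <= 4 * L * (2 * K + 1) by rewrite mulr_ge0 //; lra.
exists (4 * (4 * L * (2 * K + 1)) + 3 * K); first by lra.
move=> C C0; exists (8 * (C + 4 * L * (2 * K + 1) + 2 * K + 2)).
move=> _ _ [x [a1 [a2 hx]] <-] [y [b1 [b2 hy]] <-].
have := bigon_close fp L1 C0 hx; have := bigon_close fp L1 C0 hy.
have := metric_triangle (Vtx R x) (Vtx R x0) (Vtx R y).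
by rewrite (metric_sym (Vtx R x) (Vtx R x0)); lra.
Qed.
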